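(* Let $K_i=[a_i,b_i,c_i,d_i]$, $i=1,2,3$, be three oriented circles or lines, not all of which are straight lines, having a single common point $(\overline X,\overline Y)\in\mathbb{R}^2$, i.e. $K_i$ is generated by the curvature element $\{\overline X,\overline Y,\tau_i,a_i\}$, with $\Delta_4\ne0$; here $U=0$ and $\overline X=-\Delta_2/\Delta_4$, $\overline Y=-\Delta_3/\Delta_4$. Then the solution of the oriented Apollonius problem, i.e. the oriented circle (or line) $K_0=[a_0,b_0,c_0,d_0]$ tangent to all three ($Q(K_0,K_i)=0$ for $i=1,2,3$), is $$a_0=\frac{W}{2V},\qquad b_0=-a_0\overline X-\frac{\Delta_{ac}}{\Delta_4},\qquad c_0=-a_0\overline Y+\frac{\Delta_{ab}}{\Delta_4},\qquad d_0=\frac{b_0^2+c_0^2-1}{a_0}=\frac{a_0\Delta_1-2\Delta_{bc}}{\Delta_4}.$$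
   Context: An oriented circle or line is a quadruple of reals $K=[a,b,c,d]$ with $b^2+c^2-ad=1$, representing the curve $N(x,y)=a(x^2+y^2)+2bx+2cy+d=0$. Here $a$ is its signed curvature: for $a\ne0$ it is the circle of radius $1/|a|$ centred at $(-b/a,-c/a)$, for $a=0$ it is a straight line. The orientation is such that points with $N<0$ lie to the left of the curve. The circle or line generated by the curvature element $\{x_0,y_0,\tau_0,k_0\}$ is the one through the point $(x_0,y_0)$ with tangent direction angle $\tau_0$ there and signed curvature $k_0$; its quadruple is $[k_0,\,-k_0x_0+\sin\tau_0,\,-k_0y_0-\cos\tau_0,\,k_0(x_0^2+y_0^2)-2x_0\sin\tau_0+2y_0\cos\tau_0]$. The inversive invariant of two oriented circles or lines is defined by $4Q(K_1,K_2)=2+a_1d_2+a_2d_1-2(b_1b_2+c_1c_2)$. Tangency (coincidence of tangent vectors at the common point) means $Q=0$. Notation for a triple $K_1,K_2,K_3$: $Q_1=Q(K_1,K_2)$, $Q_2=Q(K_2,K_3)$, $Q_3=Q(K_3,K_1)$; $U=Q_1^2+Q_2^2+Q_3^2-2(Q_1Q_2+Q_2Q_3+Q_3Q_1)+4Q_1Q_2Q_3$; $v_i=Q_i(Q_i-Q_j-Q_k)$ for $\{i,j,k\}=\{1,2,3\}$; $$V=\sum a_iv_j,\qquad W=\sum a_iQ_j(a_iQ_j-2a_jQ_k),$$ sums over $(i,j,k)\in\{(1,2,3),(2,3,1),(3,1,2)\}$. Writing $\det(p_i\ q_i\ r_i)$ for the $3\times3$ determinant whose $i$-th row is $(p_i,q_i,r_i)$,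 $i=1,2,3$: $\Delta_4=\det(a_i\ b_i\ c_i)$, $\Delta_1=-\det(b_i\ c_i\ d_i)$, $\Delta_2=-\tfrac12\det(a_i\ c_i\ d_i)$, $\Delta_3=\tfrac12\det(a_i\ b_i\ d_i)$, $\Delta_{ab}=\det(a_i\ b_i\ 1)$, $\Delta_{ac}=\det(a_i\ c_i\ 1)$, $\Delta_{bc}=\det(b_i\ c_i\ 1)$. *)

(* Defs.v *)
From mathcomp Require Import all_boot all_order all_algebra.
From mathcomp Require Import all_classical all_reals all_analysis.

Set Implicit Arguments.
Unset Strict Implicit.
Unset Printing Implicit Defensive.

Import Order.TTheory GRing.Theory Num.Theory.

Local Open Scope ring_scope.

Record quad (R : Type) := Quad { qa : R; qb : R; qc : R; qd : R }.

Section Curves.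
Variable R : realType.
Implicit Types (K : quad R) (x y tau k : R).

Definition oriented K : Prop := qb K ^+ 2 + qc K ^+ 2 - qa K * qd K = 1.

Definition curveN K x y : R :=
  qa K * (x ^+ 2 + y ^+ 2) + 2 * qb K * x + 2 * qc K * y + qd K.

Definition on_curve K x y : Prop := curveN K x y = 0.

Definition straight K : Prop := qa K = 0.

Definition generated x y tau k : quad R :=
  Quad k
       (- k * x + sin tau)
       (- k * y - cos tau)
       (k * (x ^+ 2 + y ^+ 2) - 2 * x * sin tau + 2 * y * cos tau).

Definition invQ K1 K2 : R :=
  (2 + qa K1 * qd K2 + qa K2 * qd K1 - 2 * (qb K1 * qb K2 + qc K1 * qc K2)) / 4.

Definition tangent K1 K2 : Prop := invQ K1 K2 = 0.

End Curves.

(* The curves of a triple are numbered by 'I_3, whose addition is modulo 3: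
   if i is the first index of one of the cyclic triples (i, j, k), then
   j = i + 1 and k = i + 2. *)
Section Triples.
Variables (R : realType) (K : 'I_3 -> quad R).

Definition tripQ (i : 'I_3) : R := invQ (K i) (K (i + 1)).

Definition tripU : R :=
  \sum_i tripQ i ^+ 2 - 2 * (\sum_i tripQ i * tripQ (i + 1))
  + 4 * \prod_i tripQ i.

Definition tripv (i : 'I_3) : R :=
  tripQ i * (tripQ i - tripQ (i + 1) - tripQ (i + 2)).

Definition tripV : R := \sum_i qa (K i) * tripv (i + 1).

Definition tripW : R :=
  \sum_i qa (K i) * tripQ (i + 1) *
    (qa (K i) * tripQ (i + 1) - 2 * qa (K (i + 1)) * tripQ (i + 2)).

Definition det3 (p q r : 'I_3 -> R) : R :=
  \det (\matrix_(i < 3, j < 3) [:: p i; q i; r i]`_j).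

Let a i := qa (K i).
Let b i := qb (K i).
Let c i := qc (K i).
Let d i := qd (K i).
Let one (_ : 'I_3) : R := 1.

Definition Delta1 : R := - det3 b c d.
Definition Delta2 : R := - (1 / 2) * det3 a c d.
Definition Delta3 : R := 1 / 2 * det3 a b d.
Definition Delta4 : R := det3 a b c.
Definition Delta_ab : R := det3 a b one.
Definition Delta_ac : R := det3 a c one.
Definition Delta_bc : R := det3 b c one.

(* A quadruple counts as a solution only if it represents an oriented circle
   or line. *)
Definition apollonius_solution (K0 : quad R) : Prop :=
  oriented K0 /\ forall i, tangent K0 (K i).

End Triples.

(* Main.v *)
Require Import Defs.
From mathcomp Require Import all_boot all_order all_algebra.
From mathcomp Require Import all_classical all_reals all_analysis.
From mathcomp Require Import ring.

Import Order.TTheory GRing.Theory Num.Theory.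

Local Open Scope ring_scope.

(** Let [(X, Y)] be the common point. A curve through it with signed curvature
[k] is determined by [k] and a unit vector [n = (u, w)], the gradient of
[curveN / 2] there ([through]); write [(a_i, u_i, w_i)] for the three given
curves. An arbitrary quadruple [K0] is described near the same point by its
curvature [a0], its half gradient [m = (b0 + a0 X, c0 + a0 Y)] and its value
[e = curveN K0 X Y]. In these coordinates

- tangency with the [i]-th curve is the linear equation
  [a_i (- e / 2) + n_i . m = 1] ([tangent_through]), which does not involve
  [a0];
- [K0] is oriented if and only if [|m|^2 - a0 e = 1] ([oriented_at]).

The three tangency equations have determinant [Delta4], so by Cramer's rule
they fix [m] and [e] ([tangent_all_through]); these are the formulas for [b0],
[c0] and [d0]. Orientation then gives [a0 = (|m|^2 - 1) / e] as soon as
[e <> 0]. Since [Q_i = (1 - n_i . n_j) / 2], the forms [V] and [W] are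
polynomials in the [a_i] and [n_i], and for the [m] and [e] just found the
relations [|n_i|^2 = 1] turn them into
[V = Delta4^2 e / 8] and [W = Delta4^2 (|m|^2 - 1) / 4] ([tripV_through],
[tripW_through]), so that [a0 = W / (2 V)].

There remains the case [e = 0], that is [V = 0], where the formula for [a0] is
meaningless. A solution would then satisfy [|m| = 1] and [n_i . m = 1], hence
[n_i = m] for every [i], and [Delta4] would vanish. So there is no solution in
that case, and the equivalence holds as stated ([solution_through]). *)

(** * Sums, products and determinants over three indices *)

Lemma sum3E (V : nmodType) (F : 'I_3 -> V) :
  \sum_i F i = F 0 + F 1 + F 2.
Proof.
rewrite !big_ord_recl big_ord0 addr0 addrA.
by congr (F _ + F _ + F _); apply/val_inj.
Qed.

Lemma prod3E (R : comPzRingType) (F : 'I_3 -> R) :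
  \prod_i F i = F 0 * F 1 * F 2.
Proof.
rewrite !big_ord_recl big_ord0 mulr1 mulrA.
by congr (F _ * F _ * F _); apply/val_inj.
Qed.

Lemma all3E (P : 'I_3 -> Prop) : (forall i, P i) <-> [/\ P 0, P 1 & P 2].
Proof.
split=> [h|[h0 h1 h2] i]; first by split.
have [->|[->|->]] // : i = 0 \/ i = 1 \/ i = 2.
by case: i => [[|[|[|//]]] p]; [left | right; left | right; right];
  apply/val_inj.
Qed.

Lemma I3_addE :
  (((0 : 'I_3) + 1 = 1)%R * ((1 : 'I_3) + 1 = 2)%R * ((2 : 'I_3) + 1 = 0)%R *
   ((0 : 'I_3) + 2 = 2)%R * ((1 : 'I_3) + 2 = 0)%R * ((2 : 'I_3) + 2 = 1)%R)%type.
Proof. by do !split; apply/val_inj. Qed.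

Section Determinants.
Variable R : realType.
Implicit Types p q r t : 'I_3 -> R.

Lemma det2E (M : 'M[R]_2) : \det M = M 0 0 * M 1 1 - M 0 1 * M 1 0.
Proof.
rewrite (expand_det_row _ 0) !big_ord_recl big_ord0 /cofactor !det_mx11 !mxE.
have -> : lift 0 0 = 1 :> 'I_2 by apply/val_inj.
have -> : lift 1 0 = 0 :> 'I_2 by apply/val_inj.
by rewrite /= addr0 expr0 expr1 mul1r mulN1r mulrN.
Qed.

Lemma det3E p q r :
  det3 p q r = p 0 * (q 1 * r 2 - q 2 * r 1)
             - q 0 * (p 1 * r 2 - p 2 * r 1)
             + r 0 * (p 1 * q 2 - p 2 * q 1).
Proof.
have lift1 (h : 'I_3) (k : 'I_2) (j : 'I_3) : bump h k = j -> lift h k = j.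
  by move=> E; apply/val_inj.
rewrite /det3 (expand_det_row _ 0) sum3E /cofactor !det2E !mxE.
rewrite (lift1 0 0 1) // (lift1 0 1 2) // (lift1 1 0 0) // (lift1 1 1 2) //.
rewrite (lift1 2 0 0) // (lift1 2 1 1) //=.
by ring.
Qed.

Lemma cramer3 p q r t (x y z : R) : det3 p q r != 0 ->
  (forall i, p i * x + q i * y + r i * z = t i) <->
  [/\ det3 p q r * x = det3 t q r,
      det3 p q r * y = det3 p t r &
      det3 p q r * z = det3 p q t].
Proof.
move=> D0; split=> [E|[Ex Ey Ez] i].
  by rewrite !det3E -!E; split; ring.
apply/(mulfI D0); rewrite !mulrDr !(mulrCA (det3 p q r)) Ex Ey Ez.
by move: i; apply/all3E; rewrite !det3E; split; ring.
Qed.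

End Determinants.

(** * Curves through a common point *)

Section CommonPoint.
Variables (R : realType) (X Y : R).

(** The unit normal [(u, w)] replaces the tangent angle [tau], with
[(u, w) = (sin tau, - cos tau)], so that everything below is polynomial. *)
Definition through (k u w : R) : quad R :=
  Quad k (u - k * X) (w - k * Y) (k * (X ^+ 2 + Y ^+ 2) - 2 * X * u - 2 * Y * w).

Lemma generated_through tau k :
  generated X Y tau k = through k (sin tau) (- cos tau).
Proof. by congr Quad; ring. Qed.

(** Translating the origin to [(X, Y)] turns [b], [c], [d] into the half
gradient and the value of [curveN] at that point, and preserves the form
[b^2 + c^2 - a d]. *)
Lemma oriented_at (K0 : quad R) :
  oriented K0 <->
  (qb K0 + qa K0 * X) ^+ 2 + (qc K0 + qa K0 * Y) ^+ 2
  - qa K0 * curveN K0 X Y = 1.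
Proof.
have <- : qb K0 ^+ 2 + qc K0 ^+ 2 - qa K0 * qd K0 =
    (qb K0 + qa K0 * X) ^+ 2 + (qc K0 + qa K0 * Y) ^+ 2
    - qa K0 * curveN K0 X Y by rewrite /curveN; ring.
by [].
Qed.

(** After translation to [(X, Y)] the second curve has [d = 0], so the
curvature of [K0] disappears from the inversive invariant. *)
Lemma tangent_through (K0 : quad R) k u w :
  tangent K0 (through k u w) <->
  k * (- curveN K0 X Y / 2) + u * (qb K0 + qa K0 * X)
  + w * (qc K0 + qa K0 * Y) = 1.
Proof.
set L := (X in _ <-> X = 1).
have -> : tangent K0 (through k u w) = ((1 - L) / 2 = 0).
  by congr (_ = 0); rewrite /L /invQ /curveN /=; field.
split=> [/eqP|->]; last by rewrite subrr mul0r.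
by rewrite mulf_eq0 invr_eq0 pnatr_eq0 orbF subr_eq0 => /eqP.
Qed.

Variables (a u w : 'I_3 -> R).
Let K i := through (a i) (u i) (w i).
Let one (_ : 'I_3) : R := 1.

Lemma Delta4_through : Delta4 K = det3 a u w.
Proof. by rewrite /Delta4 !det3E /K /one /=; ring. Qed.

Lemma Delta_ab_through : Delta_ab K = det3 a u one.
Proof. by rewrite /Delta_ab !det3E /K /one /=; ring. Qed.

Lemma Delta_ac_through : Delta_ac K = det3 a w one.
Proof. by rewrite /Delta_ac !det3E /K /one /=; ring. Qed.

Lemma Delta_bc_through :
  Delta_bc K = det3 u w one - X * Delta_ac K + Y * Delta_ab K.
Proof. by rewrite /Delta_bc /Delta_ac /Delta_ab !det3E /K /one /=; ring. Qed.

Lemma Delta1_through : Delta1 K = (X ^+ 2 + Y ^+ 2) * Delta4 K.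
Proof. by rewrite /Delta1 /Delta4 !det3E /K /one /=; ring. Qed.

Lemma Delta2_through : Delta2 K = - X * Delta4 K.
Proof. by rewrite /Delta2 /Delta4 !det3E /K /one /=; field. Qed.

Lemma Delta3_through : Delta3 K = - Y * Delta4 K.
Proof. by rewrite /Delta3 /Delta4 !det3E /K /one /=; field. Qed.

Hypothesis uw1 : forall i, u i ^+ 2 + w i ^+ 2 = 1.

Let u2 i : u i ^+ 2 = 1 - w i ^+ 2.
Proof. by rewrite -(uw1 i) addrK. Qed.

Lemma tripQ_through i :
  tripQ K i = (1 - (u i * u (i + 1) + w i * w (i + 1))) / 2.
Proof. by rewrite /tripQ /invQ /K /=; field. Qed.

(** The angles between the three curves at their common point add up to zero;
[U = 0] is this relation in terms of the squared sines [Q_i] of the half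
angles. *)
Lemma tripU_through : tripU K = 0.
Proof.
rewrite /tripU !sum3E prod3E !tripQ_through !I3_addE.
by field: (u2 0) (u2 1) (u2 2).
Qed.

(** With [theta_i] the half angle whose squared sine is [Q_i], so that
[theta_1 + theta_2 + theta_3 = 0], the law of cosines gives
[v_i = 2 Q_i sin theta_j sin theta_k cos theta_i], which is proportional to
[sin (2 theta_i)], that is to the cofactor of an [a_l] in [Delta4]. The common
factor, the product of the three sines, is up to a constant the determinant of
the rows [(u_i, w_i, 1)], which is twice the signed area of the triangle of the
unit normals. *)
Lemma tripV_through : tripV K = - (Delta4 K * det3 u w one) / 4.
Proof.
rewrite Delta4_through /tripV sum3E /tripv !I3_addE !tripQ_through !I3_addE.
rewrite !det3E /K /one /=.
by field: (u2 0) (u2 1) (u2 2).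
Qed.

(** As a quadratic form in the [a_i], four times the right-hand side has
coefficients [|n_j - n_k|^2 - (n_j x n_k)^2 = 4 Q^2] on the diagonal, since
[|n_j - n_k|^2 = 4 Q] and [(n_j x n_k)^2 = 4 Q (1 - Q)]; the mixed coefficients
are [- 8 Q_j Q_k] by the same kind of computation. *)
Lemma tripW_through :
  tripW K = (Delta_ac K ^+ 2 + Delta_ab K ^+ 2 - Delta4 K ^+ 2) / 4.
Proof.
rewrite Delta4_through Delta_ac_through Delta_ab_through.
rewrite /tripW sum3E !I3_addE !tripQ_through !I3_addE !det3E /K /one /=.
by field: (u2 0) (u2 1) (u2 2).
Qed.

Hypothesis D4_neq0 : Delta4 K != 0.

(** Cramer's rule for the unknowns [- e / 2] and the half gradient. *)
Lemma tangent_all_through (K0 : quad R) :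
  (forall i, tangent K0 (K i)) <->
  [/\ Delta4 K * (qb K0 + qa K0 * X) = - Delta_ac K,
      Delta4 K * (qc K0 + qa K0 * Y) = Delta_ab K &
      Delta4 K * curveN K0 X Y = - 2 * det3 u w one].
Proof.
have D0 : det3 a u w != 0 by rewrite -Delta4_through.
have := cramer3 _ _ _ _ one (- curveN K0 X Y / 2) (qb K0 + qa K0 * X)
  (qc K0 + qa K0 * Y) D0.
rewrite -Delta4_through -Delta_ab_through => cramer.
have acE : det3 a one w = - Delta_ac K.
  by rewrite Delta_ac_through !det3E; ring.
have bcE : det3 one u w = det3 u w one by rewrite !det3E; ring.
rewrite acE bcE in cramer.
split=> [tan|[Eb Ec Ee]].
  have [|Ee -> ->] := cramer.1; first by move=> i; apply/tangent_through/tan.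
  by split=> //; rewrite mulNr -Ee; field.
move=> i; apply/tangent_through; move: i; apply/cramer; split=> //.
by rewrite mulrA mulrN Ee; field.
Qed.

(** Tangency determines the half gradient [m] and the value [e]; orientation is
then the single equation [a0 e = |m|^2 - 1] for the curvature. *)
Lemma solution_through (K0 : quad R) :
  apollonius_solution K K0 <->
  [/\ tripV K != 0, qa K0 = tripW K / (2 * tripV K),
      Delta4 K * (qb K0 + qa K0 * X) = - Delta_ac K,
      Delta4 K * (qc K0 + qa K0 * Y) = Delta_ab K &
      Delta4 K * curveN K0 X Y = - 2 * det3 u w one].
Proof.
pose mx := qb K0 + qa K0 * X; pose my := qc K0 + qa K0 * Y.
pose e := curveN K0 X Y.
have VE : Delta4 K * e = - 2 * det3 u w one -> tripV K = Delta4 K ^+ 2 * e / 8.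
  by move=> Ee; rewrite tripV_through expr2 -[_ * _ * e]mulrA Ee; field.
have WE : Delta4 K * mx = - Delta_ac K -> Delta4 K * my = Delta_ab K ->
    tripW K = Delta4 K ^+ 2 * (mx ^+ 2 + my ^+ 2 - 1) / 4.
  by move=> Eb Ec; rewrite tripW_through -Ec -[Delta_ac K]opprK -Eb; field.
split=> [[/oriented_at or_K0 tan]|[V0 a0E Eb Ec Ee]]; last first.
  split; last by apply/tangent_all_through.
  have e0 : e != 0 by apply: contraNneq V0 => e0; rewrite VE // e0 mulr0 mul0r.
  apply/oriented_at; rewrite -/mx -/my -/e a0E VE // WE //.
  by field; rewrite D4_neq0 e0.
have [Eb Ec Ee] := (tangent_all_through K0).1 tan.
rewrite -/mx -/my -/e in Eb Ec Ee or_K0.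
have a0e : mx ^+ 2 + my ^+ 2 - 1 = qa K0 * e by rewrite -or_K0; ring.
(* If e = 0, then m is a unit vector with n_i . m = 1, and the equality case of
   Cauchy-Schwarz forces all three normals to coincide with m. *)
have e0 : e != 0.
  apply: contraNneq D4_neq0 => e0.
  have mE : mx ^+ 2 + my ^+ 2 = 1 by rewrite -or_K0 e0; ring.
  have uwE i : u i = mx /\ w i = my.
    have /tangent_through := tan i.
    rewrite -/mx -/my -/e e0 oppr0 mul0r mulr0 add0r => dot1.
    have : (u i - mx) ^+ 2 + (w i - my) ^+ 2 = 0.
      have -> : (u i - mx) ^+ 2 + (w i - my) ^+ 2 =
        (u i ^+ 2 + w i ^+ 2) + (mx ^+ 2 + my ^+ 2)
        - 2 * (u i * mx + w i * my) by ring.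
      by rewrite uw1 mE dot1; ring.
    move/eqP; rewrite paddr_eq0 ?sqr_ge0 // !sqrf_eq0 !subr_eq0.
    by case/andP=> /eqP -> /eqP ->.
  apply/eqP; rewrite Delta4_through det3E.
  have [-> ->] := uwE 0; have [-> ->] := uwE 1; have [-> ->] := uwE 2.
  by ring.
have V0 : tripV K != 0.
  by rewrite VE // !mulf_neq0 ?expf_neq0 ?invr_eq0 ?pnatr_eq0.
split=> //; rewrite VE // WE // a0e.
by field; rewrite D4_neq0 e0.
Qed.

End CommonPoint.

(** * The oriented Apollonius problem *)

Theorem mainTheorem3 (R : realType) (K : 'I_3 -> quad R) (X Y : R)
    (tau : 'I_3 -> R)
    (K_oriented : forall i, oriented (K i))
    (K_not_all_lines : ~ (forall i, straight (K i)))
    (K_single_point :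
       forall x y, (forall i, on_curve (K i) x y) <-> (x = X /\ y = Y))
    (K_generated : forall i, K i = generated X Y (tau i) (qa (K i)))
    (D4_neq0 : Delta4 K <> 0) :
  tripU K = 0 /\
  X = - Delta2 K / Delta4 K /\
  Y = - Delta3 K / Delta4 K /\
  (forall K0 : quad R,
     apollonius_solution K K0 <->
     (tripV K <> 0 /\
      qa K0 = tripW K / (2 * tripV K) /\
      qb K0 = - qa K0 * X - Delta_ac K / Delta4 K /\
      qc K0 = - qa K0 * Y + Delta_ab K / Delta4 K /\
      (qa K0 <> 0 -> qd K0 = (qb K0 ^+ 2 + qc K0 ^+ 2 - 1) / qa K0) /\
      qd K0 = (qa K0 * Delta1 K - 2 * Delta_bc K) / Delta4 K)).
Proof.
pose a i := qa (K i); pose u i := sin (tau i); pose w i := - cos (tau i).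
have uw1 i : u i ^+ 2 + w i ^+ 2 = 1 by rewrite sqrrN addrC cos2Dsin2.
have KE : K = fun i => through R X Y (a i) (u i) (w i).
  by apply/funext => i; rewrite K_generated generated_through.
have bcE := Delta_bc_through R X Y a u w.
clearbody a u w.
move: D4_neq0; rewrite KE => /eqP D40.
split; first exact: tripU_through.
split; first by rewrite Delta2_through !mulNr opprK mulfK.
split; first by rewrite Delta3_through !mulNr opprK mulfK.
move=> K0; rewrite Delta1_through bcE.
split=> [sol|[/eqP V0 [a0E [Eb [Ec [_ Ed]]]]]]; last first.
  apply/(solution_through _ _ _ _ _ _ uw1 D40); split=> //.
  - by rewrite Eb; field.
  - by rewrite Ec; field.
  - by rewrite /curveN Ed Eb Ec; field.
have [V0 a0E Eb Ec Ee] := (solution_through _ _ _ _ _ _ uw1 D40 K0).1 sol.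
split; first exact/eqP.
split=> //.
rewrite -[Delta_ac _]opprK -Eb -Ec; split; first by field.
split; first by field.
split.
  have [or_K0 _] := sol.
  by move=> /eqP a0; rewrite -or_K0; field.
apply: (mulfI D40); rewrite [RHS]mulrC divfK //.
set D := det3 _ _ _ in Ee *.
(* Exposes the factor - 2 * D of Ee, to express D through curveN. *)
have -> : D = - (- 2 * D) / 2 by field.
by rewrite -Ee /curveN; field.
Qed.
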